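(* Let $\widetilde\Gamma(x)=\frac1x e^{x\log 2}\prod_{k=1}^\infty\left(e^{-x/k}(1+x/k)\right)^{(-1)^{k+1}}$. For $\mathrm{Re}(x)>0$ and $n\in\mathbb{N}$, $$\left(\widetilde\Gamma(x+n)\right)^{(-1)^n}=\prod_{k=0}^{n-1}\left(\frac{2(x+k)}{\pi}\right)^{(-1)^k}\widetilde\Gamma(x).$$ In particular $\widetilde\Gamma(x+1)\widetilde\Gamma(x)=\frac{\pi}{2x}$ and $\widetilde\Gamma(x+2)=\frac{x}{x+1}\widetilde\Gamma(x)$.
   Context: In the product defining $\widetilde\Gamma$, for odd $k$ the factor is $e^{-x/k}(1+x/k)$ and for even $k$ it is its reciprocal. $\mathbb{N}=\{1,2,3,\dots\}$. *)

(* Defs.v *)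
From HB Require Import structures.
From mathcomp Require Import all_boot all_order all_algebra.
From mathcomp Require Import all_classical all_reals all_analysis.
From mathcomp Require Import complex.

Set Implicit Arguments.
Unset Strict Implicit.
Unset Printing Implicit Defensive.

Import Order.TTheory GRing.Theory Num.Theory.
Import numFieldNormedType.Exports.

Local Open Scope classical_set_scope.
Local Open Scope ring_scope.
Local Open Scope complex_scope.

(* MathComp-Analysis has only the real exponential, hence
   e^(a + i b) := e^a (cos b + i sin b). *)
Definition cexp (R : realType) (z : R[i]) : R[i] :=
  (expR (complex.Re z) * cos (complex.Im z))
    +i* (expR (complex.Re z) * sin (complex.Im z)).

Definition gammat_partial (R : realType) (x : R[i]) (N : nat) : R[i] :=
  \prod_(1 <= k < N.+1)
    (cexp (- x / k%:R) * (1 + x / k%:R)) ^ ((-1) ^+ k.+1 : int).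

(* The infinite product is the limit of its partial products for the modulus
   topology.  The alias R[i]^o only serves to find that topology, which is not
   attached to R[i] itself; [lim] has no meaning unless the product converges,
   which it does for every x that is not a negative even integer. *)
Definition gammat (R : realType) (x : R[i]) : R[i] :=
  x^-1 * cexp (x * (ln 2)%:C) *
    lim ((gammat_partial x : nat -> R[i]^o) @ \oo).

(* Main.v *)
(* Write [altprod x N] for the product of the (1 + x/k)^((-1)^(k+1)), k <= N.
   The exponential factors of Gamma~ cancel because the alternating harmonic
   series sums to ln 2, so that Gamma~(x) = x^-1 lim_N (altprod x N); the limit
   exists because grouping the factors 2m+1 and 2m+2 gives
   1 + x / ((2m+1) (2m+2+x)).  The product altprod x N * altprod (x+1) N
   telescopes to a partial Wallis product, whence
   Gamma~(x) Gamma~(x+1) = pi / (2x), and everything else follows from this. *)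
Require Import Defs.
From mathcomp Require Import all_boot all_order all_algebra.
From mathcomp Require Import all_classical all_reals all_analysis.
From mathcomp Require Import complex.
From mathcomp Require Import ring lra zify.

Import Order.TTheory GRing.Theory Num.Theory.
Import numFieldNormedType.Exports.

Local Open Scope classical_set_scope.
Local Open Scope ring_scope.
Local Open Scope complex_scope.

(** * Convergence criteria for sequences *)

Section RealSequences.
Variable R : realType.

Lemma cvgn_even_odd (T : topologicalType) (u : nat -> T) (l : T) :
  (fun n => u n.*2) @ \oo --> l -> (fun n => u n.*2.+1) @ \oo --> l ->
  u @ \oo --> l.
Proof.
move=> he ho A lA.
have [N _ HN] := he A lA; have [M _ HM] := ho A lA.
(* Past twice the larger threshold, [n./2] exceeds both [N] and [M], whatever the parity of [n]. *)
exists (maxn N M).*2 => // n /= hn.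
have : (maxn N M <= n./2)%N by rewrite -(doubleK (maxn N M)) half_leq.
rewrite geq_max => /andP[Nn Mn].
rewrite -(odd_double_half n); case: (odd n); [exact: HM | exact: HN].
Qed.

Lemma cvgn_comp_double (T : topologicalType) (u : nat -> T) (l : T) :
  u @ \oo --> l -> (fun n => u n.*2) @ \oo --> l.
Proof.
move=> h A lA; have [N _ HN] := h A lA; exists N => // n /= hn.
by apply: HN => /=; rewrite (leq_trans hn)// -addnn leq_addr.
Qed.

(* [u + d] decreases while [u - d] increases and stays below [u + d]. *)
Lemma cvgn_telescoping_bound (u d : R^nat) :
  (forall n, 0 <= d n) -> cvgn d ->
  (forall n, `|u n.+1 - u n| <= d n - d n.+1) -> cvgn u.
Proof.
move=> d0 cd ud.
have -> : u = (u \- d) \+ d by apply/funext => n /=; rewrite subrK.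
have up n : u n + d n <= u 0%N + d 0%N.
  elim: n => // n; apply: le_trans.
  by have := ud n; rewrite ler_norml => /andP[_ ?]; lra.
apply: is_cvgD => //; apply: nondecreasing_is_cvgn.
  apply/nondecreasing_seqP => n /=.
  by have := ud n; rewrite ler_norml => /andP[? _]; lra.
exists (u 0%N + d 0%N) => _ [n _ <-] /=.
by have := up n; have := d0 n; lra.
Qed.

(** * Alternating harmonic sums and their limit [ln 2] *)

Definition altharm (N : nat) : R :=
  \sum_(1 <= k < N.+1) (-1) ^+ k.+1 / k%:R.

Lemma altharmS N : altharm N.+1 = altharm N + (-1) ^+ N.+2 / N.+1%:R.
Proof. by rewrite /altharm [LHS]big_nat_recr. Qed.

(** Flipping the sign of the even terms of the harmonic sum H_{2n} subtracts each 1/(2k) twice, that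
    is, H_n in total. *)
Lemma altharm_series n :
  altharm n.*2 = series harmonic n.*2 - series harmonic n.
Proof.
elim: n => [|n IH]; first by rewrite /altharm /series /= !big_nil subrr.
have -> : altharm n.+1.*2 =
    altharm n.*2 + n.*2.+1%:R^-1 - n.*2.+2%:R^-1.
  rewrite doubleS !altharmS -!(signr_odd _ n.*2.+2) -!(signr_odd _ n.*2.+3).
  by rewrite /= odd_double expr0 expr1 mul1r mulN1r.
rewrite IH doubleS /series /= !big_nat_recr//= /harmonic.
have -> : (n.*2.+2%:R : R) = 2 * n.+1%:R by rewrite -doubleS -mul2n natrM.
by rewrite invfM; move: (_.*2.+1%:R^-1) (n.+1%:R^-1) => a b; lra.
Qed.

(** This is ln(1 + y) <= y at y = -1/(n+1); the next lemma takes y = 1/(n+1). *)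
Lemma inv_le_lnB n : (0 < n)%N -> n.+1%:R^-1 <= ln n.+1%:R - ln n%:R :> R.
Proof.
move=> n0.
have n0' : 0 < n%:R :> R by rewrite ltr0n.
have n1 : 0 < n.+1%:R :> R by rewrite ltr0n.
rewrite -[X in X <= _]opprK lerNl opprB -ln_div ?posrE//.
have -> : n%:R / n.+1%:R = 1 - n.+1%:R^-1 :> R.
  by rewrite -[X in X / _](addrK 1) natr1 mulrBl mul1r mulfV ?lt0r_neq0.
by apply: le_ln1Dx; rewrite ltrN2 invf_lt1// ltr1n.
Qed.

Lemma lnB_le_inv n : ln n.+2%:R - ln n.+1%:R <= n.+1%:R^-1 :> R.
Proof.
have n1 : 0 < n.+1%:R :> R by rewrite ltr0n.
rewrite -ln_div ?posrE ?ltr0n//.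
have -> : n.+2%:R / n.+1%:R = 1 + n.+1%:R^-1 :> R.
  by rewrite -[n.+2]addn1 natrD mulrDl mulfV ?lt0r_neq0// mul1r.
by apply: le_ln1Dx; rewrite (lt_trans (ltrN10 _))// invr_gt0.
Qed.

(** Each term 1/k lies between ln(k+1) - ln k and ln k - ln(k-1), and both bounds telescope.
    Positivity of [n] keeps the upper bound away from ln 0. *)
Lemma series_harmonic_bounds n d : (0 < n)%N ->
  ln (n + d).+1%:R - ln n.+1%:R
    <= (series harmonic (n + d)%N - series harmonic n : R) <=
  ln (n + d)%:R - ln n%:R.
Proof.
move=> n0; elim: d => [|d IH]; first by rewrite addn0 !subrr lexx.
rewrite addnS; have -> : series harmonic (n + d).+1 =
    series harmonic (n + d)%N + (n + d).+1%:R^-1 :> R.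
  by rewrite /series /= big_nat_recr.
have := lnB_le_inv (n + d).
have : (0 < n + d)%N by rewrite addn_gt0 n0.
move/inv_le_lnB; case/andP: IH.
move: (_%:R^-1) => a h1 h2 h3 h4; apply/andP; split; lra.
Qed.

Lemma cvg_altharm_double : (fun n => altharm n.*2) @ \oo --> (ln 2 : R).
Proof.
(* The shift makes the index positive, as [series_harmonic_bounds] requires. *)
rewrite -cvg_shiftS /=.
apply: (@squeeze_cvgr _ _ _ _ (fun n => ln 2 - n.+1%:R^-1) (fun=> ln 2));
  last 2 first.
- by rewrite -[X in _ --> X]subr0; apply: cvgB (@cvg_harmonic R);
    exact: cvg_cst.
- exact: cvg_cst.
apply: nearW => n; rewrite altharm_series -addnn.
have p2 : 0 < 2 :> R by [].
have pn k : 0 < k.+1%:R :> R by rewrite ltr0n.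
have e k : ln (k.+1 + k.+1)%:R = ln 2 + ln k.+1%:R :> R.
  by rewrite addnn -mul2n natrM lnM ?posrE.
have /andP[] := series_harmonic_bounds n.+1 n.+1 isT.
(* With N = n+1, the lower bound involves ln(2N+1). Replacing it by ln(2N+2) = ln 2 + ln(N+1) costs
   at most 1/(2N+1) <= 1/N. *)
have := lnB_le_inv (n.+1 + n.+1).
have -> : (n.+1 + n.+1).+2 = (n.+2 + n.+2)%N by rewrite !addnS.
rewrite !e.
have : (n.+1 + n.+1).+1%:R^-1 <= n.+1%:R^-1 :> R.
  by rewrite lef_pV2 ?posrE// ler_nat -addnS leq_addr.
move: (n.+1%:R^-1) (_%:R^-1) => a b.
by move=> h1 h2 h3 h4; apply/andP; split; lra.
Qed.
End RealSequences.

(** * The Wallis product, from the integrals of powers of the sine *)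

Section Wallis.
Variable R : realType.

(** The recursion is the reduction formula that integration by parts gives for a primitive of
    sin^n. *)
Fixpoint sin_primitive (n : nat) (t : R) : R :=
  match n with
  | 0 => t
  | 1 => - cos t
  | m.+2 => (m.+1%:R * sin_primitive m t - sin t ^+ m.+1 * cos t) / m.+2%:R
  end.

Lemma is_derive_sin_primitive n (t : R) :
  is_derive t 1 (sin_primitive n) (sin t ^+ n).
Proof.
(* The recursion goes down by two, so the induction carries two consecutive exponents. *)
suff : is_derive t 1 (sin_primitive n) (sin t ^+ n) /\
  is_derive t 1 (sin_primitive n.+1) (sin t ^+ n.+1) by case.
elim: n => [|n [IH1 IH2]].
  split; first by rewrite expr0; exact: is_derive_id.
  rewrite expr1 -[sin t]opprK; exact: is_deriveN.
split => //.
have -> : sin_primitive n.+2 = n.+2%:R^-1 *: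
    (n.+1%:R *: sin_primitive n - (sin ^+ n.+1) * cos).
  by apply/funext => s; rewrite !fctE /= mulrC.
apply: is_derive_eq.
rewrite !fctE /GRing.scale /= !exprS.
have c2 : cos t * cos t = 1 - sin t * sin t by have := cos2Dsin2 t; lra.
move: (sin t ^+ n) => p.
rewrite (_ : _ - _ = n.+2%:R * (sin t * (sin t * p))).
  by rewrite mulKf// pnatr_eq0.
have -> : cos t * (n.+1%:R * p * cos t) = n.+1%:R * p * (1 - sin t * sin t).
  by rewrite -c2; ring.
by rewrite -[n.+2%:R]natr1; ring.
Qed.

(* The integral of sin^n over [0, pi/2], as an increment of its primitive, which
   avoids integration theory. *)
Definition wallis_integral n : R := sin_primitive n (pi / 2) - sin_primitive n 0.

Lemma wallis_integral0 : wallis_integral 0 = pi / 2.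
Proof. exact: subr0. Qed.

Lemma wallis_integral1 : wallis_integral 1 = 1.
Proof. by rewrite /wallis_integral /= cos_pihalf cos0 oppr0 sub0r opprK. Qed.

(** The boundary term sin^{n+1} cos of the reduction formula vanishes at both ends: the cosine at
    pi/2, the sine at 0. *)
Lemma wallis_integralSS n :
  wallis_integral n.+2 = n.+1%:R / n.+2%:R * wallis_integral n.
Proof.
rewrite /wallis_integral /= cos_pihalf sin0 expr0n /= mul0r.
by rewrite mulr0 !subr0 -mulrBl -mulrBr mulrAC.
Qed.

(** The difference of the two primitives has derivative sin^n (1 - sin), which is nonnegative
    between 0 and pi/2. *)
Lemma wallis_integral_le n : wallis_integral n.+1 <= wallis_integral n.
Proof.
pose f : R -> R := sin_primitive n - sin_primitive n.+1.
have df (t : R) : is_derive t 1 f (sin t ^+ n - sin t ^+ n.+1).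
  by apply: is_deriveB; exact: is_derive_sin_primitive.
have pi0 := pi_ge0 R.
have : f 0 <= f (pi / 2).
  apply: (@ger0_derive1_ndecr _ f 0 (pi / 2)) => //; last by lra.
  - move=> t; rewrite in_itv/= => /andP[t0 t1].
    rewrite derive1E (@derive_val _ _ _ _ _ _ _ (df t)).
    have s0 : 0 <= sin t by apply: sin_ge0_pi; apply/andP; split; lra.
    by rewrite subr_ge0 exprS ler_piMl ?exprn_ge0// sin_le1.
  - apply: derivable_within_continuous => t _.
    exact: (@ex_derive _ _ _ _ _ _ _ (df t)).
by rewrite /f !fctE /wallis_integral; lra.
Qed.

Lemma wallis_integral_even_gt0 n : 0 < wallis_integral n.*2.
Proof.
elim: n => [|n IH]; first by rewrite wallis_integral0 divr_gt0 ?pi_gt0.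
by rewrite doubleS wallis_integralSS mulr_gt0// divr_gt0 ?ltr0n.
Qed.

Definition wallis_prod (n : nat) : R :=
  \prod_(k < n) (k.*2.+2%:R ^+ 2 / (k.*2.+1%:R * k.*2.+3%:R)).

Lemma wallis_prodS n : wallis_prod n.+1 =
  wallis_prod n * (n.*2.+2%:R ^+ 2 / (n.*2.+1%:R * n.*2.+3%:R)).
Proof. by rewrite /wallis_prod big_ord_recr. Qed.

(** By [wallis_integralSS], the ratio of the odd integral to the even one is multiplied at each step
    by exactly the next Wallis factor. *)
Lemma wallis_prodE n : wallis_prod n * wallis_integral n.*2 =
  pi / 2 * wallis_integral n.*2.+1.
Proof.
elim: n => [|n IH].
  by rewrite /wallis_prod big_ord0 mul1r wallis_integral0 wallis_integral1 mulr1.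
rewrite wallis_prodS doubleS !wallis_integralSS.
rewrite [X in _ * X = _]mulrC mulrACA IH -[LHS]mulrA; congr (_ * _).
rewrite mulrC; congr (_ * _).
by field; rewrite -!natrD nat1r !pnatr_eq0.
Qed.

(** Writing I_k for the integrals, I_{2n+2} <= I_{2n+1} <= I_{2n}, and I_{2n+2} / I_{2n} = 1 -
    1/(2n+2) is at least 1 - 1/(n+1). *)
Lemma wallis_prod_bounds n :
  pi / 2 * (1 - n.+1%:R^-1) <= wallis_prod n <= pi / 2.
Proof.
have W0 := wallis_integral_even_gt0 n.
have -> : wallis_prod n =
    pi / 2 * (wallis_integral n.*2.+1 / wallis_integral n.*2).
  by rewrite mulrA -wallis_prodE mulfK ?lt0r_neq0.
have pi0 : 0 < pi / 2 :> R by rewrite divr_gt0 ?pi_gt0.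
apply/andP; split; last first.
  rewrite ler_piMr ?(ltW pi0)// ler_pdivrMr// mul1r.
  exact: wallis_integral_le.
rewrite ler_pM2l// ler_pdivlMr// (le_trans _ (wallis_integral_le _))//.
rewrite wallis_integralSS ler_pM2r// -[X in _ <= X / _](addrK 1) natr1.
rewrite mulrBl mul1r mulfV ?pnatr_eq0// lerD2l lerN2.
by rewrite lef_pV2 ?posrE ?ltr0n// ler_nat; lia.
Qed.

Lemma cvg_wallis_prod : wallis_prod @ \oo --> (pi / 2 : R).
Proof.
have lower : (fun n => pi / 2 * (1 - n.+1%:R^-1)) @ \oo -->
    (pi / 2 * (1 - 0) : R).
  apply: cvgM; first exact: cvg_cst.
  by apply: cvgB (@cvg_harmonic R); exact: cvg_cst.
rewrite subr0 mulr1 in lower.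
apply: (squeeze_cvgr _ lower (cvg_cst _)).
by apply: nearW => n; exact: wallis_prod_bounds.
Qed.
End Wallis.

(** * Limits of complex sequences, reduced to real ones *)

Section ComplexSequences.
Variable R : realType.
Local Notation C := (R[i]^o).
Implicit Types (u v : nat -> C) (l m : C).

Lemma cvgn_complex_cst l : ((fun=> l) : nat -> C) @ \oo --> l.
Proof. exact: cvg_cst. Qed.

Lemma cvgn_complexM u v l m : u @ \oo --> l -> v @ \oo --> m ->
  ((fun n => u n * v n) : nat -> C) @ \oo --> (l * m : C).
Proof. exact: (@cvgM R[i]). Qed.

Lemma cvgn_complexD u v l m : u @ \oo --> l -> v @ \oo --> m ->
  ((fun n => u n + v n) : nat -> C) @ \oo --> (l + m : C).
Proof. exact: (@cvgD R[i] R[i]^o). Qed.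

Lemma cvgn_complex_squeeze u l (d : R^nat) :
  (forall n, `|l - u n| <= (d n)%:C) -> d @ \oo --> (0 : R) -> u @ \oo --> l.
Proof.
move=> ud d0; apply/(@cvgrPdist_le R[i] R[i]^o) => e e0.
(* In the order on [R[i]], a positive element is real, so the real convergence applies to its real
   part. *)
have /andP[/eqP eI e0'] : (complex.Im e == 0) && (0 < complex.Re e).
  by move: e0; rewrite ltcE /= eq_sym.
have /cvgrPdist_le/(_ _ e0')[N _ HN] := d0.
exists N => // n Nn; apply: le_trans (ud n) _.
have -> : e = (complex.Re e)%:C by case: (e) eI => a b /= ->.
rewrite lecR (le_trans (ler_norm _))//.
by have := HN n Nn; rewrite /= sub0r normrN.
Qed.

Lemma cvgn_real_complex (a : R^nat) (b : R) :
  a @ \oo --> b -> ((fun n => (a n)%:C) : nat -> C) @ \oo --> (b%:C : C).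
Proof.
move=> ab; apply: (@cvgn_complex_squeeze _ _ (fun n => `|b - a n|)).
  by move=> n; rewrite -rmorphB normc_def /= expr0n addr0 sqrtr_sqr.
apply/cvgrPdist_le => e e0; have /cvgrPdist_le/(_ _ e0)[N _ HN] := ab.
by exists N => // n Nn; rewrite sub0r normrN normr_id; exact: HN.
Qed.

Lemma cvgn_Re_Im u (a b : R) :
  (fun n => complex.Re (u n)) @ \oo --> a ->
  (fun n => complex.Im (u n)) @ \oo --> b -> u @ \oo --> (a +i* b : C).
Proof.
move=> ua ub.
rewrite [X in _ --> X]complexE [X in X @ _](_ : _ = fun n =>
   (complex.Re (u n))%:C + 'i%C * (complex.Im (u n))%:C); last first.
  by apply/funext => n; rewrite -complexE.
apply: cvgn_complexD; first exact: cvgn_real_complex.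
by apply: cvgn_complexM; [exact: cvg_cst | exact: cvgn_real_complex].
Qed.

Lemma norm_complex_real (z : R[i]) : exists2 K : R, 0 <= K & `|z| = K%:C.
Proof. by rewrite normc_def; eexists; last by []; exact: sqrtr_ge0. Qed.

Lemma normc_ge_Im (z : R[i]) : `|complex.Im z|%:C <= `|z|.
Proof.
by rewrite normc_def lecR -sqrtr_sqr ler_sqrt ?lerDr ?addr_ge0 ?sqr_ge0.
Qed.

(** The increments of the real and imaginary parts are bounded by the modulus, so each part
    satisfies the real criterion. *)
Lemma is_cvgn_complex_telescoping u (d : R^nat) :
  (forall n, 0 <= d n) -> cvgn d ->
  (forall n, `|u n.+1 - u n| <= (d n - d n.+1)%:C) -> cvgn u.
Proof.
move=> d0 cd ud.
have cR : cvgn (fun n => complex.Re (u n)).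
  apply: (@cvgn_telescoping_bound _ _ d) => // n.
  rewrite -lecR (le_trans _ (ud n))// (le_trans _ (normc_ge_Re _))// lecR.
  by case: (u n.+1) (u n) => [a b] [a' b'].
have cI : cvgn (fun n => complex.Im (u n)).
  apply: (@cvgn_telescoping_bound _ _ d) => // n.
  rewrite -lecR (le_trans _ (ud n))// (le_trans _ (normc_ge_Im _))// lecR.
  by case: (u n.+1) (u n) => [a b] [a' b'].
by apply/cvg_ex; eexists; apply: cvgn_Re_Im; [exact: cR|exact: cI].
Qed.

(** * The complex exponential *)

Lemma cexpD (a b : R[i]) : cexp (a + b) = cexp a * cexp b.
Proof.
case: a b => [a a'] [b b']; rewrite /cexp /= expRD cosD sinD.
by apply/eqP; rewrite eq_complex /=; apply/andP; split; apply/eqP; ring.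
Qed.

Lemma cexp0 : cexp (0 : R[i]) = 1.
Proof. by rewrite /cexp /= expR0 cos0 sin0 mulr1 mulr0. Qed.

Lemma cexpN (a : R[i]) : cexp (- a) = (cexp a)^-1.
Proof.
have h : cexp (- a) * cexp a = 1 by rewrite -cexpD addNr cexp0.
have a0 : cexp a != 0.
  by apply: contra_eq_neq h => ->; rewrite mulr0 eq_sym oner_eq0.
by rewrite -[LHS](mulfK a0) h mul1r.
Qed.

Lemma cvgn_cexp (z : R[i]) (a : R^nat) (b : R) : a @ \oo --> b ->
  ((fun n => cexp (z * (a n)%:C)) : nat -> C) @ \oo --> (cexp (z * b%:C) : C).
Proof.
case: z => [p q] ab.
have cM c : (fun n => c * a n) @ \oo --> c * b.
  by apply: cvgM => //; exact: cvg_cst.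
(* The products with 0 come from multiplying [z] by a number with zero imaginary part; they are kept
   so that these limits match the goals below. *)
have cR : (fun n => p * a n - q * 0) @ \oo --> p * b - q * 0.
  by apply: cvgB => //; exact: cvg_cst.
have cI : (fun n => p * 0 + q * a n) @ \oo --> p * 0 + q * b.
  by apply: cvgD => //; exact: cvg_cst.
apply: cvgn_Re_Im => /=; apply: (@cvgM R); apply: continuous_cvg => //.
- exact: continuous_expR.
- exact: continuous_cos.
- exact: continuous_expR.
- exact: continuous_sin.
Qed.
End ComplexSequences.

(** * Convergence of the alternating product, and its relation to the Wallis product *)

Section AlternatingProduct.
Variable R : realType.
Local Notation C := (R[i]^o).
Implicit Type x : R[i].

Definition altprod x (N : nat) : R[i] :=
  \prod_(1 <= k < N.+1) (1 + x / k%:R) ^ ((-1) ^+ k.+1 : int).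

Lemma altprodS x N : altprod x N.+1 =
  altprod x N * (1 + x / N.+1%:R) ^ ((-1) ^+ N.+2 : int).
Proof. by rewrite /altprod [LHS]big_nat_recr. Qed.

(** The exponents -x/k, taken with their alternating signs, add up to -x times the alternating
    harmonic sum. *)
Lemma gammat_partialE x N :
  gammat_partial x N = cexp (- x * (altharm R N)%:C) * altprod x N.
Proof.
elim: N => [|N IH].
  rewrite /gammat_partial /altharm /altprod !big_nil.
  by rewrite mulr0 cexp0 mulr1.
have -> : gammat_partial x N.+1 = gammat_partial x N *
    (cexp (- x / N.+1%:R) * (1 + x / N.+1%:R)) ^ ((-1) ^+ N.+2 : int).
  by rewrite /gammat_partial [LHS]big_nat_recr.
rewrite IH altharmS altprodS rmorphD [- x * (_ + _)]mulrDr cexpD.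
rewrite mulrACA; congr (_ * _); rewrite expfzMl; congr (_ * _).
rewrite rmorphM rmorphXn rmorphN1 fmorphV rmorph_nat.
rewrite -signr_odd -[in RHS]signr_odd; case: (odd _) => /=.
  by rewrite !expr1 exprN1 -cexpN mulN1r mulrN.
by rewrite !expr0 expr1z mul1r.
Qed.

Lemma altprod_doubleS x n :
  altprod x n.*2.+1 = altprod x n.*2 * (1 + x / n.*2.+1%:R).
Proof. by rewrite altprodS -signr_odd /= odd_double expr0 expr1z. Qed.

Lemma altprod_doubleSS x n : altprod x n.+1.*2 =
  altprod x n.*2 * (1 + x / n.*2.+1%:R) / (1 + x / n.*2.+2%:R).
Proof.
by rewrite -altprod_doubleS doubleS altprodS -signr_odd /= odd_double exprN1.
Qed.

Lemma natD_neq0 x n : 0 < complex.Re x -> n%:R + x != 0.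
Proof.
move=> x0; apply: contraTneq x0 => /(congr1 (@complex.Re R)) /=.
rewrite -(rmorph_nat (real_complex R)); case: x => a b /= h.
by rewrite -leNgt -h lerDr ler0n.
Qed.

Lemma norm_natD_ge x n : 0 < complex.Re x -> n%:R <= `|n%:R + x|.
Proof.
move=> x0; apply: le_trans (normc_ge_Re _).
rewrite -(rmorph_nat (real_complex R)) lecR; case: x x0 => a b /= a0.
by rewrite (le_trans _ (ler_norm _))// lerDl ltW.
Qed.

Lemma altprod_pair x m : 0 < complex.Re x ->
  (1 + x / m.*2.+1%:R) / (1 + x / m.*2.+2%:R) =
  1 + x / (m.*2.+1%:R * (m.*2.+2%:R + x)).
Proof.
move=> x0; have h1 := natD_neq0 _ m.*2.+2 x0.
have n1 : m.*2.+1%:R != 0 :> R[i] by rewrite pnatr_eq0.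
have n2 : m.*2.+2%:R != 0 :> R[i] by rewrite pnatr_eq0.
have -> : 1 + x / m.*2.+2%:R = (m.*2.+2%:R + x) / m.*2.+2%:R.
  by rewrite mulrDl mulfV.
have -> : m.*2.+2%:R = m.*2.+1%:R + 1 :> R[i] by rewrite natr1.
rewrite -natr1 in n2 h1.
move: (m.*2.+1%:R) n1 n2 h1 => a n1 n2 h1.
by field; rewrite ?n1 ?n2 ?h1.
Qed.

(** Here 2m+1 >= m+1 and |2m+2+x| >= 2m+2 >= m+2, which bounds the quotient by |x| / ((m+1)(m+2)).
    The bound is written as a difference so that its sums telescope. *)
Lemma altprod_pair_bound x m : 0 < complex.Re x ->
  `|x / (m.*2.+1%:R * (m.*2.+2%:R + x))| <= `|x| * (m.+1%:R^-1 - m.+2%:R^-1).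
Proof.
move=> x0; rewrite normrM ler_wpM2l// normfV normrM normr_nat.
have -> : m.+1%:R^-1 - m.+2%:R^-1 = (m.+1%:R * m.+2%:R)^-1 :> R[i].
  have n1 : m.+1%:R != 0 :> R[i] by rewrite pnatr_eq0.
  have n2 : m.+2%:R != 0 :> R[i] by rewrite pnatr_eq0.
  rewrite -natr1 in n2 *; move: (m.+1%:R) n1 n2 => a n1 n2.
  by field; rewrite n1 n2.
have p k : 0 < k.+1%:R :> R[i] by rewrite ltr0n.
rewrite lef_pV2 ?posrE ?mulr_gt0// ?normr_gt0 ?natD_neq0//.
apply: ler_pM; rewrite ?ler0n// ?ler_nat; first by lia.
by apply: le_trans (norm_natD_ge _ _ x0); rewrite ler_nat; lia.
Qed.

Lemma altprod_double_bounded x : 0 < complex.Re x ->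
  exists2 K : R, 0 <= K & forall n, `|altprod x n.*2| <= K%:C.
Proof.
move=> x0; have [K K0 xK] := norm_complex_real _ x.
exists (expR K); first exact: expR_ge0.
(* The sharper bound makes the induction go through: its exponent is the telescoped sum of the pair
   bounds, and 1 + t <= exp t absorbs each new factor. *)
move=> n; apply: (@le_trans _ _ (expR (K * (1 - n.+1%:R^-1)))%:C); last first.
  by rewrite lecR ler_expR ler_piMr// gerBl invr_ge0.
elim: n => [|n IH].
  by rewrite /altprod big_nil normr1 invr1 subrr mulr0 expR0.
rewrite altprod_doubleSS -mulrA altprod_pair// normrM.
rewrite (_ : K * _ =
    K * (1 - n.+1%:R^-1) + K * (n.+1%:R^-1 - n.+2%:R^-1)); last first.
  by rewrite -mulrDr addrA subrK.
rewrite expRD rmorphM; apply: ler_pM => //.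
apply: le_trans (ler_normD _ _) _; rewrite normr1.
apply: (@le_trans _ _ (1 + K * (n.+1%:R^-1 - n.+2%:R^-1))%:C); last first.
  by rewrite lecR expR_ge1Dx.
rewrite rmorphD rmorph1 lerD2l (le_trans (altprod_pair_bound _ n x0))//.
by rewrite xK rmorphM rmorphB !fmorphV !rmorph_nat.
Qed.

(** An increment is the current product, bounded by [B], times the small term of the next pair; the
    majorant therefore telescopes. *)
Lemma is_cvgn_altprod_double x : 0 < complex.Re x ->
  cvgn ((fun n => altprod x n.*2) : nat -> C).
Proof.
move=> x0; have [B B0 hB] := altprod_double_bounded _ x0.
have [K K0 xK] := norm_complex_real _ x.
apply: (@is_cvgn_complex_telescoping _ _ (fun n => B * K * n.+1%:R^-1)).
- by move=> n; rewrite !mulr_ge0.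
- apply: is_cvgM; first exact: is_cvg_cst.
  by apply/cvg_ex; exists 0; exact: cvg_harmonic.
move=> n; rewrite altprod_doubleSS -mulrA altprod_pair// mulrDr mulr1 addrC addKr.
rewrite normrM -mulrBr -mulrA rmorphM; apply: ler_pM => //.
apply: le_trans (altprod_pair_bound _ n x0) _.
by rewrite xK rmorphM rmorphB !fmorphV !rmorph_nat.
Qed.

Lemma cvgn_inv_odd : (fun n => n.*2.+1%:R^-1) @ \oo --> (0 : R).
Proof. exact: (cvgn_comp_double _ _ _ (@cvg_harmonic R)). Qed.

(** Odd partial sums differ from the preceding even ones by 1/(2n+1), which tends to 0. *)
Lemma cvgn_altharm : altharm R @ \oo --> (ln 2 : R).
Proof.
apply: cvgn_even_odd; first exact: cvg_altharm_double.
rewrite (_ : (fun n => _) = fun n => altharm R n.*2 + n.*2.+1%:R^-1).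
  rewrite -[X in _ --> X]addr0; apply: cvgD; first exact: cvg_altharm_double.
  exact: cvgn_inv_odd.
apply/funext => n; rewrite altharmS -signr_odd /= odd_double expr0.
by rewrite mul1r.
Qed.

(** Odd partial products differ from the preceding even ones by the factor 1 + x/(2n+1), which tends
    to 1. *)
Lemma is_cvgn_altprod x : 0 < complex.Re x -> cvgn (altprod x : nat -> C).
Proof.
move=> x0; have /cvg_ex[l hl] := is_cvgn_altprod_double _ x0.
apply/cvg_ex; exists l; apply: cvgn_even_odd => //.
rewrite (_ : (fun n => _) =
    fun n => altprod x n.*2 * (1 + x * (n.*2.+1%:R^-1)%:C)).
  have h0 := cvgn_real_complex _ _ _ cvgn_inv_odd.
  have h1 := cvgn_complexM _ _ _ _ _ (cvgn_complex_cst _ x) h0.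
  have h2 := cvgn_complexD _ _ _ _ _ (cvgn_complex_cst _ 1) h1.
  have := cvgn_complexM _ _ _ _ _ hl h2.
  by rewrite rmorph0 mulr0 addr0 mulr1.
by apply/funext => n; rewrite altprod_doubleS fmorphV rmorph_nat.
Qed.

Lemma cvgn_gammat_partial x (l : C) : altprod x @ \oo --> l ->
  (gammat_partial x : nat -> C) @ \oo --> (cexp (- x * (ln 2)%:C) * l : C).
Proof.
move=> h; rewrite (_ : (gammat_partial x : nat -> C) =
    fun n => cexp (- x * (altharm R n)%:C) * altprod x n); last first.
  by apply/funext => n; exact: gammat_partialE.
exact: (cvgn_complexM _ _ _ _ _ (cvgn_cexp _ _ _ _ cvgn_altharm) h).
Qed.

Lemma gammatE x (l : C) : altprod x @ \oo --> l -> gammat x = x^-1 * l.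
Proof.
move=> h; rewrite /gammat (cvg_lim _ (cvgn_gammat_partial _ _ h)).
  by rewrite -mulrA [X in _ * X = _]mulrA -cexpD mulNr subrr cexp0 mul1r.
exact: (@norm_hausdorff R[i] R[i]^o).
Qed.

(** Since 1 + (x+1)/k = (k+1+x)/k, the numerator of factor k of the second product cancels that of
    factor k+1 of the first, whose exponent is opposite. Only 1 + x and 1/(2n+1+x) survive; the
    factors free of x form the Wallis product times 2n+1. *)
Lemma altprodM x n : 0 < complex.Re x ->
  altprod x n.*2 * altprod (x + 1) n.*2 =
  (1 + x) * (wallis_prod R n)%:C * (n.*2.+1%:R / (n.*2.+1%:R + x)).
Proof.
move=> x0; have h k := natD_neq0 _ k x0.
elim: n => [|n IH].
  rewrite /altprod /wallis_prod !big_nil big_ord0 rmorph1 !mulr1 mul1r mulfV//.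
  exact: (h 1%N).
have step a b c d c' d' : a * c / d * (b * c' / d') = a * b * (c / d * (c' / d'))
    :> R[i] by rewrite -!mulrA; congr (_ * _); ring.
rewrite !altprod_doubleSS step IH.
rewrite wallis_prodS rmorphM fmorph_div rmorphXn rmorphM !rmorph_nat doubleS.
rewrite -!mulrA; do 2 congr (_ * _).
have hx1 : n.*2.+1%:R + x != 0 := h _.
have hx2 : n.*2.+2%:R + x != 0 := h _.
have hx3 : n.*2.+3%:R + x != 0 := h _.
have n1 : n.*2.+1%:R != 0 :> R[i] by rewrite pnatr_eq0.
have n2 : n.*2.+2%:R != 0 :> R[i] by rewrite pnatr_eq0.
have n3 : n.*2.+3%:R != 0 :> R[i] by rewrite pnatr_eq0.
(* All casts are expressed through 2n+1, generalized to [a], which leaves an identity of rational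
   functions in [a] and [x]. *)
rewrite -[n.*2.+3%:R]natr1 -[n.*2.+2%:R]natr1 in hx2 hx3 n2 n3 *.
move: (n.*2.+1%:R) hx1 hx2 hx3 n1 n2 n3 => a hx1 hx2 hx3 n1 n2 n3.
by field; rewrite hx3 n3 n1 n2 hx2 hx1.
Qed.

(** With k = 2n+1, the distance to 1 is |x/(k+x)| <= |x|/k. *)
Lemma cvgn_odd_ratio x : 0 < complex.Re x ->
  ((fun n => n.*2.+1%:R / (n.*2.+1%:R + x)) : nat -> C) @ \oo --> (1 : C).
Proof.
move=> x0; have [K K0 xK] := norm_complex_real _ x.
apply: (cvgn_complex_squeeze _ _ _ (fun n => K * n.*2.+1%:R^-1)); last first.
  by rewrite -[X in _ --> X](mulr0 K); apply: cvgM cvgn_inv_odd; exact: cvg_cst.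
move=> n; have h := natD_neq0 _ n.*2.+1 x0.
rewrite -{1}(mulfV h) -mulrBl addrAC subrr add0r normrM xK rmorphM.
apply: ler_pM => //; first by rewrite -xK.
rewrite fmorphV rmorph_nat normfV lef_pV2 ?posrE ?normr_gt0 ?ltr0n//.
exact: norm_natD_ge.
Qed.
End AlternatingProduct.

(** * The functional equations *)

Section GammaTilde.
Variable R : realType.
Local Notation C := (R[i]^o).
Implicit Type x : R[i].

Lemma gammat_reflect x : 0 < complex.Re x ->
  gammat (x + 1) * gammat x = (pi : R)%:C / (2 * x).
Proof.
move=> x0.
have y0 : 0 < complex.Re (x + 1) by case: (x) x0 => a b /= a0; rewrite addr_gt0.
have /cvg_ex[l hl] := is_cvgn_altprod _ _ x0.
have /cvg_ex[m hm] := is_cvgn_altprod _ _ y0.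
rewrite (gammatE _ _ _ hl) (gammatE _ _ _ hm).
(* Both sides are limits of the sequence in [altprodM], taken along even indices, and limits are
   unique. *)
have lm : l * m = (1 + x) * (pi / 2)%:C.
  have hlm := cvgn_complexM _ _ _ _ _ (cvgn_comp_double _ _ _ hl)
    (cvgn_comp_double _ _ _ hm).
  have hw := cvgn_complexM _ _ _ _ _
    (cvgn_complexM _ _ _ _ _ (cvgn_complex_cst _ (1 + x))
      (cvgn_real_complex _ _ _ (cvg_wallis_prod R)))
    (cvgn_odd_ratio _ _ x0).
  rewrite mulr1 in hw.
  have e : (fun n => altprod R x n.*2 * altprod R (x + 1) n.*2) =
      (fun n => (1 + x) * (wallis_prod R n)%:C *
        (n.*2.+1%:R / (n.*2.+1%:R + x))).
    by apply/funext => n; exact: altprodM.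
  rewrite e in hlm.
  exact: (cvg_unique (@norm_hausdorff R[i] R[i]^o) hlm hw).
have n0 : x != 0 by have := natD_neq0 _ _ 0 x0; rewrite add0r.
have n1 : 1 + x != 0 := natD_neq0 _ _ 1 x0.
rewrite mulrACA [m * l]mulrC lm fmorph_div rmorph_nat [x + 1]addrC.
by field; rewrite n0 n1.
Qed.

Lemma Re_addn_gt0 x n : 0 < complex.Re x -> 0 < complex.Re (x + n%:R).
Proof.
rewrite -(rmorph_nat (real_complex R)); case: x => a b /= a0.
by rewrite ltr_wpDr.
Qed.

(** A zero would annihilate the left side of [gammat_reflect], whose right side is nonzero. This
    permits dividing by [gammat x] below. *)
Lemma gammat_neq0 x : 0 < complex.Re x -> gammat x != 0.
Proof.
move=> x0; have n0 : x != 0 by have := natD_neq0 _ _ 0 x0; rewrite add0r.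
have p0 : (pi : R)%:C != 0 by rewrite fmorph_eq0 lt0r_neq0 ?pi_gt0.
apply: contraTneq p0 => g0; have /eqP := gammat_reflect _ x0.
rewrite g0 mulr0 eq_sym mulf_eq0 invr_eq0 mulf_eq0 (negPf n0) pnatr_eq0 !orbF.
by move/eqP->; rewrite eqxx.
Qed.

Lemma gammatD1 x : 0 < complex.Re x ->
  gammat (x + 1) = (2 * x / (pi : R)%:C)^-1 * (gammat x)^-1.
Proof.
move=> x0; apply: (mulIf (gammat_neq0 _ x0)).
by rewrite gammat_reflect// mulfVK ?gammat_neq0// invf_div.
Qed.

(** Induction on [n], applying [gammatD1] at x + n: each unit shift inverts the function, and the
    alternating outer exponent undoes this inversion. *)
Lemma gammatDn x n : 0 < complex.Re x ->
  gammat (x + n%:R) ^ ((-1) ^+ n : int) =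
  (\prod_(0 <= k < n) (2 * (x + k%:R) / (pi : R)%:C) ^ ((-1) ^+ k : int))
    * gammat x.
Proof.
move=> x0; elim: n => [|n IH].
  by rewrite big_nil addr0 expr0 expr1z mul1r.
rewrite big_nat_recr// mulrAC -IH -natr1 addrA gammatD1 ?Re_addn_gt0//.
(* The parity of [n] turns both exponents into 1 and -1, in one order or the other. *)
rewrite -signr_odd -(signr_odd _ n) /=; case: (odd n) => /=.
  by rewrite expr0 expr1 expr1z !exprN1 mulrC.
by rewrite expr0 expr1 !expr1z exprN1 invfM !invrK mulrC.
Qed.
End GammaTilde.

Theorem theorem2p12 (R : realType) (x : R[i]) (hx : 0 < complex.Re x) :
  (forall n : nat, (0 < n)%N ->
     gammat (x + n%:R) ^ ((-1) ^+ n : int) =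
     (\prod_(0 <= k < n) (2 * (x + k%:R) / (pi : R)%:C) ^ ((-1) ^+ k : int))
       * gammat x) /\
  gammat (x + 1) * gammat x = (pi : R)%:C / (2 * x) /\
  gammat (x + 2) = x / (x + 1) * gammat x.
Proof.
split; first by move=> n _; exact: gammatDn.
split; first exact: gammat_reflect.
(* For n = 2 the outer exponent is 1, and the constants 2/pi cancel between the two factors, whose
   exponents are opposite. *)
have := gammatDn _ _ 2 hx.
rewrite big_nat_recr// big_nat1 addr0 /= sqrrN expr1n !expr1z => ->.
congr (_ * _); rewrite expr1 exprN1.
have x1 : x + 1 != 0 by rewrite addrC; exact: (natD_neq0 _ _ 1 hx).
have p0 : (pi : R)%:C != 0 by rewrite fmorph_eq0 lt0r_neq0 ?pi_gt0.
by move: ((pi : R)%:C) p0 => p p0; field; rewrite p0 x1.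
Qed.
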